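(* Let $\beta>1/2$, $m>0$, and let $X$ be a random variable with density $h_{\beta,m}(x)=C_{\beta,m}x^{-2\beta}e^{-m/x}$, $x\in(0,\infty)$, with median $\bar x_{\beta,m}$. Then for every $1\le p<\infty$ and every smooth $\phi:(0,\infty)\to\mathbb R$ with $E[|\phi(X)|^p]<\infty$, $$E\big[|\phi(X)-E(\phi(X))|^p\big]\le \big(p\,D(\beta,m)\big)^p\,E\big[X^p|\phi'(X)|^p\big],\qquad D(\beta,m)=\frac{1}{\bar x_{\beta,m}\,h_{\beta,m}(\bar x_{\beta,m})}.$$
   Context: $C_{\beta,m}>0$ is the normalizing constant making $h_{\beta,m}$ a probability density on $(0,\infty)$. The median $\bar x_{\beta,m}$ is the point where $\int_0^{\bar x_{\beta,m}}h_{\beta,m}(x)\,dx=1/2$. *)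

(* Defs.v *)
From HB Require Import structures.
From mathcomp Require Import all_boot all_order all_algebra.
From mathcomp Require Import all_classical all_reals all_analysis.
Set Implicit Arguments. Unset Strict Implicit. Unset Printing Implicit Defensive.
Import Order.TTheory GRing.Theory Num.Theory.
Import numFieldNormedType.Exports.
Local Open Scope classical_set_scope.
Local Open Scope ring_scope.

Section Defs.
Variable R : realType.
Local Notation mu := (@lebesgue_measure R).
Definition pos_half_line : set R := `]0, +oo[%classic.
Definition seg0 (b : R) : set R := `]0, b[%classic.

Definition g_bm (beta m : R) (x : R) : R := x `^ (- (2 * beta)) * expR (- (m / x)).

Definition C_bm (beta m : R) : R :=
  (fine (\int[mu]_(x in pos_half_line) (g_bm beta m x)%:E))^-1.

Definition h_bm (beta m : R) (x : R) : R := C_bm beta m * g_bm beta m x.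

Definition Eh (beta m : R) (f : R -> R) : \bar R :=
  (\int[mu]_(x in pos_half_line) (f x * h_bm beta m x)%:E)%E.

Definition is_median (beta m xbar : R) : Prop :=
  (\int[mu]_(x in seg0 xbar) (h_bm beta m x)%:E)%E = (2^-1)%:E.

Definition D_bm (beta m xbar : R) : R := (xbar * h_bm beta m xbar)^-1.

Definition smooth_pos (phi : R -> R) : Prop :=
  forall (n : nat) (x : R), 0 < x -> derivable (derive1n n phi) x 1.
End Defs.

(* Main.v *)
Require Import Defs.
From HB Require Import structures.
From mathcomp Require Import all_boot all_order all_algebra.
From mathcomp Require Import all_classical all_reals all_analysis.
From mathcomp Require Import measurable_realfun ring lra.
Set Implicit Arguments. Unset Strict Implicit. Unset Printing Implicit Defensive.
Import Order.TTheory GRing.Theory Num.Theory.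
Import numFieldNormedType.Exports.
Local Open Scope classical_set_scope.
Local Open Scope ring_scope.

(** Put [c := phi xbar], [K := D / 2] and let [F] be the distribution function of
    [X]. The density [x h(x)] of [ln X] is log-concave, so both tails are controlled
    by their value at the median: [F x <= K x h x] for [x <= xbar] and
    [1 - F x <= K x h x] for [x >= xbar]. Integrating the derivative of
    [|phi - c|^p F], resp. [|phi - c|^p (1 - F)], on each side of [xbar] and absorbing
    the cross term with Young's inequality
    [p a^(p-1) b <= (p - 1) a^p + b^p] gives the Hardy inequality
    [E |phi - c|^p <= (p K)^p E (X |phi'|)^p]. Replacing [c] by the mean costs a
    factor [2^p], by convexity of [t^p] and Jensen's inequality. *)

(** * Preliminaries on powers, derivatives and integrals *)

Lemma powRB1M (R : realType) (p x : R) : 0 < p -> 0 <= x ->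
  x `^ (p - 1) * x = x `^ p.
Proof.
move=> p0 x0; rewrite -[X in _ * X](powRr1 x0) -powRD ?subrK//.
by rewrite gt_eqF.
Qed.

(** Young's inequality for the conjugate exponents [p / (p - 1)] and [p], multiplied by [p]. At
    [p = 1] the first exponent degenerates and both sides reduce to [y]. *)
Lemma young_powR (R : realType) (p x y : R) : 1 <= p -> 0 <= x -> 0 <= y ->
  p * (x `^ (p - 1) * y) <= (p - 1) * x `^ p + y `^ p.
Proof.
rewrite le_eqVlt => /predU1P[<- x0 y0|p1 x0 y0].
  by rewrite subrr powRr0 !mul1r mul0r add0r powRr1.
have p0 : 0 < p by lra.
have pB0 : 0 < p - 1 by lra.
have := @conjugate_powR R (x `^ (p - 1)) y (p / (p - 1)) p
  (powR_ge0 _ _) y0 (divr_gt0 p0 pB0) p0.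
have -> : (p / (p - 1))^-1 + p^-1 = 1 by field; rewrite !gt_eqF.
move=> /(_ erefl); rewrite -powRrM.
have -> : (p - 1) * (p / (p - 1)) = p by field; rewrite gt_eqF.
rewrite -(ler_pM2l p0) => /le_trans; apply.
rewrite le_eqVlt; apply/predU1P; left; field.
by rewrite !gt_eqF.
Qed.

(** Convexity at the midpoint [s]: Young's inequality for [s] against [x] and against [y] adds up to
    [2 p s^p <= 2 (p - 1) s^p + x^p + y^p]. *)
Lemma powR_add_le (R : realType) (p x y : R) : 1 <= p -> 0 <= x -> 0 <= y ->
  2 * (x + y) `^ p <= 2 `^ p * (x `^ p + y `^ p).
Proof.
move=> p1 x0 y0; have p0 : 0 < p by lra.
pose s := (x + y) / 2; have s0 : 0 <= s by rewrite divr_ge0 ?addr_ge0.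
have -> : x + y = 2 * s by rewrite /s; field.
rewrite powRM// mulrCA ler_pM2l ?powR_gt0//.
have Hx := @young_powR R p s x p1 s0 x0; have Hy := @young_powR R p s y p1 s0 y0.
have Hs := powRB1M p0 s0.
have : s `^ (p - 1) * x + s `^ (p - 1) * y = 2 * s `^ p.
  by rewrite -Hs /s; field.
nra.
Qed.

Lemma is_derive_ge0_le (R : realType) (f df : R -> R) (a b : R) : a <= b ->
  (forall x, a <= x <= b -> is_derive x 1 f (df x)) ->
  (forall x, a <= x <= b -> 0 <= df x) -> f a <= f b.
Proof.
move=> ab fdf df0.
have cf : {within `[a, b], continuous f}.
  apply: derivable_within_continuous => x; rewrite in_itv/= => /fdf fx.
  exact: ex_derive.
have [|c] := @MVT_segment R f df a b ab _ cf.
  by move=> x; rewrite in_itv/= => /andP[ax xb]; apply: fdf; rewrite !ltW.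
rewrite in_itv/= => /df0 dfc fE.
by rewrite -subr_ge0 fE mulr_ge0// subr_ge0.
Qed.

Lemma is_derive_le0_ge (R : realType) (f df : R -> R) (a b : R) : a <= b ->
  (forall x, a <= x <= b -> is_derive x 1 f (df x)) ->
  (forall x, a <= x <= b -> df x <= 0) -> f b <= f a.
Proof.
move=> ab fdf df0; rewrite -lerN2.
apply: (@is_derive_ge0_le R (- f) (fun x => - df x)) => // x xab.
  by have := fdf x xab => ?; exact: is_deriveN.
by rewrite oppr_ge0; exact: df0.
Qed.

Lemma is_derive1_continuous (R : realType) (f : R -> R) (x df : R) :
  is_derive x 1 f df -> {for x, continuous f}.
Proof.
by move=> fx; apply/differentiable_continuous/derivable1_diffP; exact: ex_derive.
Qed.

Lemma continuous_pos_measurable (R : realType) (f : R -> R) :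
  (forall x, 0 < x -> {for x, continuous f}) ->
  measurable_fun (@pos_half_line R) f.
Proof.
move=> cf; apply: open_continuous_measurable_fun; first exact: interval_open.
by move=> x; rewrite inE /pos_half_line/= in_itv/= andbT; exact: cf.
Qed.

Lemma segment_sub_pos (R : realType) (a b : R) : 0 < a ->
  `[a, b]%classic `<=` @pos_half_line R.
Proof.
move=> a0 x; rewrite /pos_half_line/= !in_itv/= andbT => /andP[+ _].
exact: lt_le_trans.
Qed.

Section segments.
Context (R : realType).
Local Notation mu := (@lebesgue_measure R).

(* The segments [x0 / (n + 1), x0 (n + 1)] exhaust the half-line. *)
Lemma ge0_integral_pos_le (f : R -> R) (x0 : R) (M : \bar R) : 0 < x0 ->
  measurable_fun (@pos_half_line R) f ->
  (forall x, 0 < x -> 0 <= f x) ->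
  (forall a b, 0 < a -> a <= x0 -> x0 <= b ->
    (\int[mu]_(x in `[a, b]) (f x)%:E <= M)%E) ->
  (\int[mu]_(x in @pos_half_line R) (f x)%:E <= M)%E.
Proof.
move=> x00 mf f0 H.
pose A (n : nat) : set R := `[x0 / n.+1%:R, x0 * n.+1%:R]%classic.
have n0 (n : nat) : 0 < n.+1%:R :> R by [].
have A0 n : A n `<=` @pos_half_line R by apply: segment_sub_pos; rewrite divr_gt0.
have UA : \bigcup_n A n = @pos_half_line R.
  apply/seteqP; split => [x [n _]|x]; first exact: A0.
  rewrite /pos_half_line/= in_itv/= andbT => x_gt0.
  (* The successor of this sum exceeds both [x0 / x] and [x / x0], which places [x] above the left
     end and below the right end. *)
  exists (Num.truncn (x0 / x) + Num.truncn (x / x0))%N => //=.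
  have t1 := truncnS_gt (x0 / x); have t2 := truncnS_gt (x / x0).
  rewrite /A/= in_itv/= ler_pdivrMr// mulrC -ler_pdivrMr// [x0 * _%:R]mulrC -ler_pdivrMr//.
  apply/andP; split.
    by rewrite (le_trans (ltW t1))// ler_nat ltnS leq_addr.
  by rewrite (le_trans (ltW t2))// ler_nat ltnS leq_addl.
have cv : (\int[mu]_(x in A n) (f x)%:E @[n --> \oo] -->
    \int[mu]_(x in \bigcup_n A n) (f x)%:E)%E.
  apply: ge0_nondecreasing_set_cvg_integral.
  - move=> m n mn; apply/subsetPset => x; rewrite /A/= !in_itv/= => /andP[h1 h2].
    apply/andP; split.
      apply: le_trans h1; rewrite ler_pM2l// lef_pV2 ?posrE//.
      by rewrite ler_nat ltnS.
    by apply: (le_trans h2); rewrite ler_pM2l// ler_nat ltnS.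
  - by move=> n; exact: measurable_itv.
  - by move=> n; apply/measurable_EFinP; apply: measurable_funS (A0 n) mf; exact: measurable_itv.
  - by move=> n x /A0; rewrite /pos_half_line/= in_itv/= andbT lee_fin; exact: f0.
rewrite -UA -(cvg_lim _ cv)//; apply: lime_le; first by apply/cvg_ex; eexists; exact: cv.
apply: nearW => n; apply: H.
- by rewrite divr_gt0.
- by rewrite ler_pdivrMr// ler_peMr ?(ltW x00) ?ler1n.
- by rewrite ler_peMr ?(ltW x00) ?ler1n.
Qed.
End segments.

(** * Replacing the mean by an arbitrary constant *)

Lemma le_integrable_EFin d (T : measurableType d) (R : realType)
    (mu : {measure set T -> \bar R}) (D : set T) (f g : T -> R) :
  measurable D -> measurable_fun D f -> (forall x, D x -> `|f x| <= g x) ->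
  mu.-integrable D (EFin \o g) -> mu.-integrable D (EFin \o f).
Proof.
move=> mD mf fg; apply: le_integrable => //; first exact/measurable_EFinP.
move=> x /fg fgx /=; rewrite lee_fin (le_trans fgx)//.
exact: ler_norm.
Qed.

Lemma ge0_integrable_EFin d (T : measurableType d) (R : realType)
    (mu : {measure set T -> \bar R}) (D : set T) (f : T -> R) :
  measurable D -> measurable_fun D f -> (forall x, D x -> 0 <= f x) ->
  (\int[mu]_(x in D) (f x)%:E < +oo)%E -> mu.-integrable D (EFin \o f).
Proof.
move=> mD mf f0 foo; apply/integrableP; split; first exact/measurable_EFinP.
suff -> : (\int[mu]_(x in D) `|(EFin \o f) x| = \int[mu]_(x in D) (f x)%:E)%E by [].
by apply: eq_integral => x; rewrite inE => /f0 fx0; rewrite /= ger0_norm.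
Qed.

Section centered_moment.
Context d (T : measurableType d) (R : realType).
Variables (mu : {measure set T -> \bar R}) (D : set T) (h phi : T -> R) (p : R).
Hypotheses (mD : measurable D) (p1 : 1 <= p).
Hypotheses (mh : measurable_fun D h) (mphi : measurable_fun D phi).
Hypotheses (h0 : forall x, D x -> 0 <= h x)
  (h1 : (\int[mu]_(x in D) (h x)%:E = 1)%E)
  (phip : (\int[mu]_(x in D) (`|phi x| `^ p * h x)%:E < +oo)%E).

Let p0 : 0 < p. Proof. exact: lt_le_trans p1. Qed.

Let mphiB c : measurable_fun D (fun x => phi x - c).
Proof. by apply: measurable_funB => //; exact: measurable_cst. Qed.

Let mphip c : measurable_fun D (fun x => `|phi x - c| `^ p * h x).
Proof.
apply: measurable_funM => //.
apply: (@measurableT_comp _ _ _ _ _ _ (fun x : R => x `^ p)) => //.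
exact: measurableT_comp.
Qed.

Let ih : mu.-integrable D (EFin \o h).
Proof. by apply: ge0_integrable_EFin => //; rewrite h1 ltry. Qed.

Let iphip : mu.-integrable D (EFin \o (fun x => `|phi x| `^ p * h x)).
Proof.
apply: ge0_integrable_EFin => //.
  by under eq_fun do rewrite -(subr0 (phi _)); exact: mphip.
by move=> x Dx; rewrite mulr_ge0 ?powR_ge0 ?h0.
Qed.

(** Domination by [2^p (|phi|^p + |c|^p) h]: a finite [p]-th moment about 0 gives one about every
    constant. *)
Let iphiBp c : mu.-integrable D (EFin \o (fun x => `|phi x - c| `^ p * h x)).
Proof.
apply: (@le_integrable_EFin _ _ _ _ _ _
    (fun x => 2 `^ p * (`|phi x| `^ p * h x) + 2 `^ p * (`|c| `^ p * h x))) => //.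
- move=> x Dx; have hx := h0 Dx.
  rewrite ger0_norm ?mulr_ge0 ?powR_ge0//.
  rewrite -mulrDr -mulrDl mulrA ler_wpM2r//.
  apply: (@le_trans _ _ (2 * (`|phi x| + `|c|) `^ p)); last exact: powR_add_le.
  apply: (@le_trans _ _ ((`|phi x| + `|c|) `^ p)).
    by apply: ge0_ler_powR; rewrite ?nnegrE ?addr_ge0 ?(ltW p0)// ler_normB.
  by rewrite ler_peMl ?powR_ge0// ler1n.
- have := integrableD mD (integrableZl mD (2 `^ p) iphip)
    (integrableZl mD (2 `^ p * `|c| `^ p) ih).
  by apply: eq_integrable => // x _ /=; rewrite -EFinD !mulrA.
Qed.

(** Domination through [|t| <= 1 + |t|^p], which is Young's inequality with first argument 1. *)
Let iphiB c : mu.-integrable D (EFin \o (fun x => (phi x - c) * h x)).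
Proof.
apply: (@le_integrable_EFin _ _ _ _ _ _
    (fun x => h x + `|phi x - c| `^ p * h x)) => //.
- exact: measurable_funM.
- move=> x Dx; have hx := h0 Dx.
  rewrite normrM (ger0_norm hx) -{2}(mul1r (h x)) -mulrDl ler_wpM2r//.
  have := @young_powR R p 1 `|phi x - c| p1 ler01 (normr_ge0 _).
  rewrite !powR1/= mul1r mulr1.
  have := powR_ge0 `|phi x - c| p; set z := _ `^ p; set y := `|_| => z0 H.
  have zp : 0 <= (p - 1) * z by rewrite mulr_ge0// subr_ge0.
  rewrite -(ler_pM2l p0); lra.
- have := integrableD mD ih (iphiBp c).
  by apply: eq_integrable.
Qed.

Let Rh : (\int[mu]_(x in D) h x)%R = 1.
Proof. by rewrite /Rintegral h1. Qed.

Let e := fine (\int[mu]_(x in D) (phi x * h x)%:E)%E.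

Let eB c : (\int[mu]_(x in D) ((phi x - c) * h x))%R = e - c.
Proof.
have -> : e = (\int[mu]_(x in D) ((phi x - c) * h x + c * h x))%R.
  by apply: eq_Rintegral => x _; rewrite -mulrDl subrK.
rewrite RintegralD// ?RintegralZl// ?Rh; first by rewrite mulr1 addrK.
by have := integrableZl mD c ih; apply: eq_integrable.
Qed.

(* Jensen's inequality, by integrating Young's inequality
   [p |e - c|^(p-1) |phi - c| <= (p - 1) |e - c|^p + |phi - c|^p]. *)
Let jensen c : `|e - c| `^ p <= (\int[mu]_(x in D) (`|phi x - c| `^ p * h x))%R.
Proof.
set m := `|e - c|; have m0 : 0 <= m := normr_ge0 _.
have iy : mu.-integrable D (EFin \o (fun x => `|(phi x - c) * h x|)).
  exact: (integrable_norm (iphiB c)).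
have mY : m <= (\int[mu]_(x in D) `|(phi x - c) * h x|)%R.
  by rewrite /m -eB; apply: le_normr_Rintegral => //; exact: iphiB.
have : ((p * m `^ (p - 1)) * \int[mu]_(x in D) `|(phi x - c) * h x| <=
    (p - 1) * m `^ p * \int[mu]_(x in D) h x +
    \int[mu]_(x in D) (`|phi x - c| `^ p * h x))%R.
  rewrite -!RintegralZl// -RintegralD//; last first.
    by have := integrableZl mD ((p - 1) * m `^ p) ih; apply: eq_integrable.
  apply: le_Rintegral => //.
  - by have := integrableZl mD (p * m `^ (p - 1)) iy; apply: eq_integrable.
  - have := integrableD mD (integrableZl mD ((p - 1) * m `^ p) ih) (iphiBp c).
    by apply: eq_integrable.
  - move=> x Dx; have hx := h0 Dx.
    rewrite normrM (ger0_norm hx) mulrA -mulrDl ler_wpM2r// -mulrA.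
    exact: young_powR.
rewrite Rh mulr1 => H.
have : p * m `^ p <= (p - 1) * m `^ p + \int[mu]_(x in D) (`|phi x - c| `^ p * h x).
  apply: le_trans H; rewrite -(powRB1M p0 m0) mulrA ler_wpM2l//.
  by rewrite mulr_ge0 ?powR_ge0// ltW.
lra.
Qed.

(** From [|phi - e| <= |phi - c| + |e - c|] and convexity, [2 |phi - e|^p <= 2^p (|phi - c|^p + |e -
    c|^p)]. Integrated against the probability density [h], the second term is at most the first by
    Jensen's inequality, and the factor 2 cancels. *)
Lemma centered_moment_le c :
  (\int[mu]_(x in D) (`|phi x - e| `^ p * h x)%:E <=
   (2 `^ p)%:E * \int[mu]_(x in D) (`|phi x - c| `^ p * h x)%:E)%E.
Proof.
have RE c' : (\int[mu]_(x in D) (`|phi x - c'| `^ p * h x)%:E =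
    (\int[mu]_(x in D) (`|phi x - c'| `^ p * h x))%R%:E)%E.
  by rewrite /Rintegral fineK//; exact: (integrable_fin_num mD (iphiBp c')).
rewrite !RE -EFinM lee_fin -(ler_pM2l (ltr0n R 2)).
set A := (\int[mu]_(x in D) (`|phi x - c| `^ p * h x))%R.
apply: (@le_trans _ _ (2 `^ p * (A + `|e - c| `^ p * \int[mu]_(x in D) h x)%R)).
  rewrite -RintegralZl// -RintegralD//; last first.
    by have := integrableZl mD (`|e - c| `^ p) ih; apply: eq_integrable.
  rewrite -!RintegralZl//; last first.
    have := integrableD mD (iphiBp c) (integrableZl mD (`|e - c| `^ p) ih).
    by apply: eq_integrable.
  apply: le_Rintegral => //.
  - by have := integrableZl mD 2 (iphiBp e); apply: eq_integrable.
  - have := integrableZl mD (2 `^ p) (integrableD mD (iphiBp c)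
      (integrableZl mD (`|e - c| `^ p) ih)).
    by apply: eq_integrable => // x _ /=; rewrite -EFinD.
  - move=> x Dx; have hx := h0 Dx.
    rewrite -mulrDl !mulrA ler_wpM2r//.
    apply: le_trans (powR_add_le p1 (normr_ge0 _) (normr_ge0 _)).
    rewrite ler_pM2l//; apply: ge0_ler_powR; rewrite ?nnegrE ?addr_ge0 ?(ltW p0)//.
    have -> : phi x - e = (phi x - c) - (e - c) by ring.
    exact: ler_normB.
rewrite Rh mulr1 mulrCA ler_wpM2l ?powR_ge0//.
have := jensen c; rewrite -/A; lra.
Qed.

End centered_moment.

(** * A Hardy inequality on a segment *)

Lemma integral_segment_is_derive (R : realType) (F f : R -> R) (a b : R) :
  a <= b ->
  (forall x : R, a <= x <= b -> is_derive x 1 F (f x)) ->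
  (forall x : R, a <= x <= b -> {for x, continuous f}) ->
  (\int[@lebesgue_measure R]_(x in `[a, b]) (f x)%:E = (F b - F a)%:E)%E.
Proof.
(* The degenerate case does occur: the first segment of the exhaustion is the single point [x0]. *)
rewrite le_eqVlt => /predU1P[<- _ _|ab dF cf].
  by rewrite set_itv1 integral_set1 subrr.
have cF (x : R) : a <= x <= b -> {for x, continuous F}.
  by move=> /dF; exact: is_derive1_continuous.
rewrite (@continuous_FTC2 _ f F) ?EFinB//.
- by apply: continuous_subspace_itv => x; rewrite in_itv/=; exact: cf.
- split.
  + move=> x; rewrite in_itv/= => /andP[ax xb].
    by have := dF x; rewrite !ltW// => /(_ isT) ?; exact: ex_derive.
  + by apply: cvg_at_right_filter; apply: cF; rewrite lexx ltW.
  + by apply: cvg_at_left_filter; apply: cF; rewrite lexx ltW.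
- move=> x; rewrite in_itv/= => /andP[ax xb].
  rewrite derive1E; have := dF x; rewrite !ltW// => /(_ isT) ?.
  exact: derive_val.
Qed.

Lemma integrable_segment_continuous (R : realType) (f : R -> R) (a b : R) :
  (forall x : R, a <= x <= b -> {for x, continuous f}) ->
  (@lebesgue_measure R).-integrable `[a, b] (EFin \o f).
Proof.
move=> cf; apply: continuous_compact_integrable; first exact: segment_compact.
by apply: continuous_subspace_itv => x; rewrite in_itv/=; exact: cf.
Qed.

Section hardy_segment.
Context (R : realType).
Local Notation mu := (@lebesgue_measure R).
Variables (phi h T : R -> R) (c p K eps sigma a b : R).
Hypotheses (a0 : 0 < a) (ab : a <= b) (p1 : 1 <= p) (eps0 : 0 < eps) (K0 : 0 < K).
Hypotheses (dphi : forall x : R, 0 < x -> derivable phi x 1)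
  (ddphi : forall x : R, 0 < x -> derivable (derive1 phi) x 1).
Hypotheses (h0 : forall x : R, 0 < x -> 0 <= h x)
  (ch : forall x : R, 0 < x -> {for x, continuous h}).
Hypotheses (sigma1 : `|sigma| = 1)
  (dT : forall x : R, 0 < x -> is_derive x 1 T (- sigma * h x))
  (TK : forall x : R, a <= x <= b -> 0 <= T x <= K * (x * h x)).

Let p0 : 0 < p. Proof. exact: lt_le_trans p1. Qed.

(* [s ^ (1/2)] is a smooth positive substitute for [|phi - c|], which makes the
   [p]-th power differentiable for every [p >= 1]. *)
Let s x := (phi x - c) * (phi x - c) + eps.
(** [T] is the tail pointing away from the median: the distribution function with [sigma = -1] on
    the left, its complement with [sigma = 1] on the right. [G] is the product whose derivative [dG]
    is integrated. *)
Let G x := s x `^ (p / 2) * T x.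
Let dG x := s x `^ (p / 2) * (- sigma * h x) +
  T x * (p * s x `^ (p / 2 - 1) * ((phi x - c) * derive1 phi x)).

Let s_gt0 x : 0 < s x.
Proof. by rewrite /s ltr_wpDl// -expr2 sqr_ge0. Qed.

Let is_derive_phi (x : R) : 0 < x -> is_derive x 1 phi (derive1 phi x).
Proof. by move=> /dphi /derivableP; rewrite derive1E. Qed.

Let is_derive_s (x : R) : 0 < x -> is_derive x 1 s (2 * ((phi x - c) * derive1 phi x)).
Proof.
move=> x0; have dp := is_derive_phi x0.
have dB := is_deriveB dp (is_derive_cst c x 1).
have := is_deriveD (is_deriveM dB dB) (is_derive_cst eps x 1).
move=> H; apply: (is_derive_eq H).
by rewrite !fctE /= /GRing.scale/= subr0 addr0; ring.
Qed.

Let is_derive_G (x : R) : 0 < x -> is_derive x 1 G (dG x).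
Proof.
move=> x0.
have ds := is_derive1_comp (is_derive1_powR (p / 2) (s_gt0 x)) (is_derive_s x0).
have H := is_deriveM ds (dT x0).
apply: (is_derive_eq H).
by rewrite /dG /= /GRing.scale/=; field.
Qed.

Let cspow q (x : R) : 0 < x -> {for x, continuous (fun y => s y `^ q)}.
Proof.
move=> x0; apply: is_derive1_continuous.
exact: (is_derive1_comp (is_derive1_powR q (s_gt0 x)) (is_derive_s x0)).
Qed.

Let cphi' (x : R) : 0 < x -> {for x, continuous (derive1 phi)}.
Proof. by move=> /ddphi ?; exact/differentiable_continuous/derivable1_diffP. Qed.

(** The fundamental theorem of calculus needs a continuous derivative; the second derivative of
    [phi] supplies the continuity of [phi']. *)
Let cdG (x : R) : 0 < x -> {for x, continuous dG}.
Proof.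
move=> x0; apply: continuousD.
- apply: continuousM; first exact: cspow.
  by apply: continuousM; [exact: cvg_cst|exact: ch].
- apply: continuousM; first exact: is_derive1_continuous (dT x0).
  apply: continuousM.
    by apply: continuousM; [exact: cvg_cst|exact: cspow].
  apply: continuousM; last exact: cphi'.
  apply: continuousB; last exact: cvg_cst.
  exact: is_derive1_continuous (is_derive_phi x0).
Qed.

Let k x := (p * K) `^ p * (x `^ p * `|derive1 phi x| `^ p * h x).

(** With [w = s^(1/2)], the relation [sigma^2 = 1] makes [- p sigma dG] equal to [p w^p h] minus a
    cross term. The bounds [T <= K x h] and [|phi - c| <= w] give at most [p w^(p-1) y h] for that
    term, where [y = p K x |phi'|], hence at most [((p - 1) w^p + y^p) h] by Young. As
    [k x = y^p h], what is left is [w^p h], which dominates [|phi - c|^p h]. *)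
Let pointwise (x : R) : a <= x <= b ->
  `|phi x - c| `^ p * h x <= k x - p * sigma * dG x.
Proof.
move=> xab; have x0 : 0 < x by case/andP : xab => + _; exact: lt_le_trans.
have hx := h0 x0; have /andP[T0 TKx] := TK xab.
set u := phi x - c; set u' := derive1 phi x.
pose w := s x `^ 2^-1; have w0 : 0 <= w := powR_ge0 _ _.
have uw : `|u| <= w.
  rewrite /w powR12_sqrt ?(ltW (s_gt0 x))// -(sqrtr_sqr u); apply: ler_wsqrtr.
  by rewrite /s -/u -expr2 lerDl ltW.
have wp : s x `^ (p / 2) = w `^ p by rewrite /w -powRrM mulrC.
have wp1 : s x `^ (p / 2 - 1) * w = w `^ (p - 1).
  rewrite {1}/w -powRD; last by rewrite (gt_eqF (s_gt0 x)) implybT.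
  by rewrite /w -powRrM; congr (_ `^ _); field.
pose y := p * K * x * `|u'|.
have y0 : 0 <= y by rewrite !mulr_ge0// ltW.
have yp : (p * K) `^ p * (x `^ p * `|u'| `^ p) = y `^ p.
  rewrite /y (powRM _ _ (normr_ge0 u')) ?powRM ?mulr_ge0 ?ltW//.
  by rewrite !mulrA.
have Y := young_powR p1 w0 y0.
have up : `|u| `^ p <= w `^ p.
  by apply: ge0_ler_powR; rewrite ?nnegrE ?(ltW p0).
have ss : sigma * sigma = 1 by rewrite -expr2 -real_normK ?num_real// sigma1 expr1n.
have cross : p * sigma * (T x * (p * s x `^ (p / 2 - 1) * (u * u'))) <=
    p * (w `^ (p - 1) * y) * h x.
  apply: (le_trans (ler_norm _)).
  rewrite !normrM sigma1 (ger0_norm T0) (ger0_norm (ltW p0)).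
  rewrite (ger0_norm (powR_ge0 _ _)) mulr1 -!mulrA ler_pM2l//.
  rewrite -wp1 /y.
  have : 0 <= s x `^ (p / 2 - 1) by exact: powR_ge0.
  set z := s x `^ _ => z0.
  apply: (@le_trans _ _ (K * (x * h x) * (p * (z * (w * `|u'|))))); last first.
    by rewrite le_eqVlt; apply/predU1P; left; ring.
  apply: ler_pM => //.
    by rewrite !mulr_ge0// ltW.
  by rewrite ler_pM2l// ler_wpM2l// ler_wpM2r.
have -> : k x = y `^ p * h x by rewrite /k -/u' mulrA yp.
rewrite /dG -/u -/u' wp.
have -> : y `^ p * h x - p * sigma * (w `^ p * (- sigma * h x) +
   T x * (p * s x `^ (p / 2 - 1) * (u * u'))) = y `^ p * h x +
   p * (sigma * sigma) * w `^ p * h x -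
   p * sigma * (T x * (p * s x `^ (p / 2 - 1) * (u * u'))) by ring.
rewrite ss mulr1.
have := ler_wpM2r hx Y; have := ler_wpM2r hx up.
nra.
Qed.

(** This is [pointwise] integrated over the segment; the derivative [dG] contributes only boundary
    values. *)
Lemma hardy_segment :
  mu.-integrable `[a, b] (EFin \o k) ->
  (\int[mu]_(x in `[a, b]) (`|phi x - c| `^ p * h x)%:E <=
   \int[mu]_(x in `[a, b]) (k x)%:E + (p * sigma * (G a - G b))%:E)%E.
Proof.
move=> ik.
have gt0 (x : R) : a <= x <= b -> 0 < x by case/andP => + _; exact: lt_le_trans.
have dpG (x : R) : a <= x <= b -> is_derive x 1 (fun y => p * sigma * G y) (p * sigma * dG x).
  move=> /gt0 x0; have H := is_deriveM (is_derive_cst (p * sigma) x 1) (is_derive_G x0).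
  by apply: (is_derive_eq H); rewrite /GRing.scale/= mulr0 addr0.
have cpdG (x : R) : a <= x <= b -> {for x, continuous (fun y => p * sigma * dG y)}.
  by move=> /gt0 x0; apply: continuousM; [exact: cvg_cst|exact: cdG].
have idG := integrable_segment_continuous cpdG.
have sub : `[a, b]%classic `<=` @pos_half_line R := segment_sub_pos a0.
have mseg (g : R -> R) : measurable_fun (@pos_half_line R) g -> measurable_fun `[a, b] g.
  by apply: measurable_funS => //; exact: measurable_itv.
have -> : (p * sigma * (G a - G b))%:E = (- \int[mu]_(x in `[a, b]) (p * sigma * dG x)%:E)%E.
  by rewrite (integral_segment_is_derive ab dpG cpdG) -EFinN; congr EFin; ring.
rewrite -integralB_EFin//; apply: ge0_le_integral => //.
- by move=> x /sub; rewrite /pos_half_line/= in_itv/= andbT => x0;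
    rewrite lee_fin mulr_ge0 ?powR_ge0 ?h0.
- apply/measurable_EFinP; apply: (mseg (fun x => `|phi x - c| `^ p * h x)).
  apply: measurable_funM; last first.
    exact: continuous_pos_measurable.
  apply: (@measurableT_comp _ _ _ _ _ _ (fun x : R => x `^ p)) => //.
  apply: measurableT_comp => //; apply: continuous_pos_measurable => x x0.
  apply: continuousB; last exact: cvg_cst.
  exact: is_derive1_continuous (is_derive_phi x0).
- by apply: emeasurable_funB; [exact: measurable_int ik|exact: measurable_int idG].
Qed.

End hardy_segment.

(** * Distribution function and tails *)

Section cdf.
Context (R : realType).
Local Notation mu := (@lebesgue_measure R).
Variable h : R -> R.
Hypotheses (h0 : forall x : R, 0 < x -> 0 <= h x)
  (ch : forall x : R, 0 < x -> {for x, continuous h})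
  (h1 : (\int[mu]_(x in @pos_half_line R) (h x)%:E = 1)%E).

Definition cdf_pos (t : R) : R := (\int[mu]_(x in `]0, t]) h x)%R.

Let ih : mu.-integrable (@pos_half_line R) (EFin \o h).
Proof.
apply: ge0_integrable_EFin; first exact: measurable_itv.
- exact: continuous_pos_measurable.
- by move=> x; rewrite /pos_half_line/= in_itv/= andbT; exact: h0.
- by rewrite h1 ltry.
Qed.

Let sub t : `]0, t]%classic `<=` @pos_half_line R.
Proof. by move=> x; rewrite /pos_half_line/= !in_itv/= andbT => /andP[]. Qed.

Let iht t : mu.-integrable `]0, t] (EFin \o h).
Proof. by apply: integrableS ih; [exact: measurable_itv|exact: measurable_itv|exact: sub]. Qed.

Lemma cdf_posE (t : R) : (\int[mu]_(x in `]0%R, t]) (h x)%:E = (cdf_pos t)%:E)%E.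
Proof.
rewrite /cdf_pos /Rintegral fineK//.
by apply: (integrable_fin_num _ (iht t)); exact: measurable_itv.
Qed.

Lemma is_derive_cdf_pos (t : R) : 0 < t -> is_derive t 1 cdf_pos (h t).
Proof.
move=> t0; have tu : t < t + 1 by rewrite ltrDl.
have [||dF FE] := @continuous_FTC1 R h (BRight 0) t (t + 1) tu (iht _).
- exact: t0.
- exact: ch.
- have dF' : derivable cdf_pos t 1 := dF.
  have FE' : derive1 cdf_pos t = h t := FE.
  by apply: (DeriveDef dF'); rewrite -derive1E.
Qed.

Lemma cdf_pos_ge0 t : 0 <= cdf_pos t.
Proof.
by apply: Rintegral_ge0 => x; rewrite /= in_itv/= => /andP[/h0].
Qed.

Lemma cdf_pos_le1 t : cdf_pos t <= 1.
Proof.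
rewrite -lee_fin -cdf_posE -h1; apply: ge0_subset_integral => //.
- exact: measurable_itv.
- by apply/measurable_EFinP; exact: continuous_pos_measurable.
- by move=> x; rewrite /pos_half_line/= in_itv/= andbT lee_fin; exact: h0.
Qed.

Let increment (a b : R) : 0 < a -> a <= b ->
  (\int[mu]_(x in `[a, b]) (h x)%:E = (cdf_pos b - cdf_pos a)%:E)%E.
Proof.
move=> a0 ab; apply: integral_segment_is_derive => // x /andP[ax _].
- by apply: is_derive_cdf_pos; exact: lt_le_trans ax.
- by apply: ch; exact: lt_le_trans ax.
Qed.

Let le1 (l : R) : (forall a b : R, 0 < a -> a <= 1 -> 1 <= b ->
  cdf_pos b - cdf_pos a <= l) -> 1 <= l.
Proof.
move=> H; rewrite -lee_fin -h1.
apply: (ge0_integral_pos_le ltr01) => //; first exact: continuous_pos_measurable.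
move=> a b a0 a1 b1; rewrite increment ?lee_fin//; first exact: H.
exact: le_trans b1.
Qed.

(** Plays the part of the limit 1 of [cdf_pos] at infinity: the mass of a segment [[a, b]] is at
    most [cdf_pos b], and segments exhaust the total mass 1. *)
Lemma cdf_pos_ub (l : R) : (forall b : R, 0 < b -> cdf_pos b <= l) -> 1 <= l.
Proof.
move=> H; apply: le1 => a b a0 a1 b1.
by rewrite (le_trans _ (H b (lt_le_trans ltr01 b1)))// gerBl cdf_pos_ge0.
Qed.

(** Plays the part of the limit 0 of [cdf_pos] at 0: otherwise every segment would have mass at most
    [1 - l < 1]. *)
Lemma cdf_pos_lb (l : R) : (forall a : R, 0 < a -> l <= cdf_pos a) -> l <= 0.
Proof.
move=> H; rewrite -subr_ge0 sub0r -(lerD2l 1) addr0; apply: le1 => a b a0 _ _.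
by apply: lerB; [exact: cdf_pos_le1|exact: H].
Qed.

(* [s] is the logarithmic derivative, in the variable [ln x], of the density
   [x h x] of [ln X]: its monotonicity is the log-concavity of that density. *)
Section tails.
Variables (s : R -> R) (xm K : R).
Hypotheses (xm0 : 0 < xm) (K0 : 0 < K)
  (ds : forall x : R, 0 < x -> is_derive x 1 (fun y => y * h y) (h x * s x))
  (s_dec : forall x y : R, 0 < x -> x <= y -> s y <= s x)
  (Kxm : K * (xm * h xm) = 2^-1) (Fxm : cdf_pos xm = 2^-1).

Let f x := x * h x.

(** Used with [k = 1] on the right and [k = -1] on the left. Since [s] is nonincreasing, the
    derivative passes at most once from nonnegative to nonpositive. *)
Let is_derive_J (k : R) (x : R) : 0 < x ->
  is_derive x 1 (fun y => K * f y + k * cdf_pos y) (h x * (K * s x + k)).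
Proof.
move=> x0.
have d1 := is_deriveM (is_derive_cst K x 1) (ds x0).
have d2 := is_deriveM (is_derive_cst k x 1) (is_derive_cdf_pos x0).
apply: (is_derive_eq (is_deriveD d1 d2)).
by rewrite /GRing.scale/=; ring.
Qed.

Let cdf_mono (x y : R) : 0 < x -> x <= y -> cdf_pos x <= cdf_pos y.
Proof.
move=> x0 xy; apply: (is_derive_ge0_le xy) => z /andP[xz _].
- by apply: is_derive_cdf_pos; exact: lt_le_trans xz.
- by apply: h0; exact: lt_le_trans xz.
Qed.

(** The claim is [J x >= 1] for [J = K f + cdf_pos], and [J xm = 1]. If [K s x + 1 >= 0], then [J]
    increases on [[xm, x]]. Otherwise [J] decreases beyond [x], so [J x >= J b >= cdf_pos b] for all
    [b >= x], and [b] tends to infinity. *)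
Lemma cdf_right_tail x : xm <= x -> 1 - cdf_pos x <= K * (x * h x).
Proof.
move=> xmx; have x0 : 0 < x := lt_le_trans xm0 xmx.
have [s0|s0] := leP 0 (K * s x + 1).
  have : K * f xm + 1 * cdf_pos xm <= K * f x + 1 * cdf_pos x.
    apply: (is_derive_ge0_le xmx (fun z zI => is_derive_J 1 _)) => z /andP[xz zx].
      exact: lt_le_trans xz.
    have z0 : 0 < z := lt_le_trans xm0 xz.
    rewrite mulr_ge0 ?h0// (le_trans s0)// lerD2r ler_pM2l//.
    exact: s_dec.
  by rewrite /f Kxm Fxm; lra.
have H (b : R) : 0 < b -> cdf_pos b <= K * f x + cdf_pos x.
  move=> b0; have [bx|/ltW xb] := leP b x.
    rewrite (le_trans (cdf_mono b0 bx))// lerDr !mulr_ge0 ?h0// ltW//.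
  have : K * f b + 1 * cdf_pos b <= K * f x + 1 * cdf_pos x.
    apply: (is_derive_le0_ge xb (fun z zI => is_derive_J 1 _)) => z /andP[xz zx].
      exact: lt_le_trans xz.
    have z0 : 0 < z := lt_le_trans x0 xz.
    rewrite mulr_ge0_le0 ?h0// (le_trans _ (ltW s0))// lerD2r ler_pM2l//.
    exact: s_dec.
  have : 0 <= K * f b by rewrite !mulr_ge0 ?h0 ?ltW.
  lra.
by have := cdf_pos_ub H; rewrite /f; lra.
Qed.

(** Mirror argument for [J = K f - cdf_pos], with [J xm = 0]: either [J] decreases on [[x, xm]], or
    it increases up to [x], so that [J x >= - cdf_pos a] for all [a <= x], and [a] tends to 0. *)
Lemma cdf_left_tail x : 0 < x -> x <= xm -> cdf_pos x <= K * (x * h x).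
Proof.
move=> x0 xxm.
have [s0|s0] := leP (K * s x + -1) 0.
  have : K * f xm + -1 * cdf_pos xm <= K * f x + -1 * cdf_pos x.
    apply: (is_derive_le0_ge xxm (fun z zI => is_derive_J (-1) _)) => z /andP[xz zx].
      exact: lt_le_trans xz.
    have z0 : 0 < z := lt_le_trans x0 xz.
    rewrite mulr_ge0_le0 ?h0// (le_trans _ s0)// lerD2r ler_pM2l//.
    exact: s_dec.
  by rewrite /f Kxm Fxm; lra.
have H (a : R) : 0 < a -> cdf_pos x - K * f x <= cdf_pos a.
  move=> a0; have [xa|/ltW ax] := leP x a.
    rewrite (le_trans _ (cdf_mono x0 xa))// gerBl !mulr_ge0 ?h0// ltW//.
  have : K * f a + -1 * cdf_pos a <= K * f x + -1 * cdf_pos x.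
    apply: (is_derive_ge0_le ax (fun z zI => is_derive_J (-1) _)) => z /andP[xz zx].
      exact: lt_le_trans xz.
    have z0 : 0 < z := lt_le_trans a0 xz.
    rewrite mulr_ge0 ?h0// (le_trans (ltW s0))// lerD2r ler_pM2l//.
    exact: s_dec.
  have : 0 <= K * f a by rewrite !mulr_ge0 ?h0 ?ltW.
  lra.
by have := cdf_pos_lb H; rewrite /f; lra.
Qed.

End tails.
End cdf.

(** * The Hardy inequality around the median *)

Section hardy_median.
Context (R : realType).
Local Notation mu := (@lebesgue_measure R).
Variables (phi h F : R -> R) (p K xm : R).
Hypotheses (p1 : 1 <= p) (K0 : 0 < K) (xm0 : 0 < xm).
Hypotheses (dphi : forall x : R, 0 < x -> derivable phi x 1)
  (ddphi : forall x : R, 0 < x -> derivable (derive1 phi) x 1).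
Hypotheses (h0 : forall x : R, 0 < x -> 0 <= h x)
  (ch : forall x : R, 0 < x -> {for x, continuous h})
  (dF : forall x : R, 0 < x -> is_derive x 1 F (h x))
  (F01 : forall x : R, 0 <= F x <= 1)
  (Fleft : forall x : R, 0 < x -> x <= xm -> F x <= K * (x * h x))
  (Fright : forall x : R, xm <= x -> 1 - F x <= K * (x * h x)).

Let p0 : 0 < p. Proof. exact: lt_le_trans p1. Qed.

Let P := @pos_half_line R.

Let mP : measurable P. Proof. exact: measurable_itv. Qed.

Let split_integral (f : R -> R) (a b : R) : 0 < a -> a <= xm -> xm <= b ->
  measurable_fun P f -> (forall x : R, 0 < x -> 0 <= f x) ->
  (\int[mu]_(x in `[a, b]) (f x)%:E = \int[mu]_(x in `[a, xm]) (f x)%:E +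
    \int[mu]_(x in `[xm, b]) (f x)%:E)%E.
Proof.
move=> a0 axm xmb mf f0.
have mfS (A : set R) : A `<=` P -> measurable_fun A (EFin \o f).
  by move=> AP; apply/measurable_EFinP; exact: measurable_funS AP mf.
have subP : `[a, b]%classic `<=` P by exact: segment_sub_pos.
have abE : `[a, b]%classic = `[a, xm]%classic `|` `]xm, b]%classic.
  by rewrite -itv_bndbnd_setU// bnd_simp.
rewrite abE ge0_integral_setU//; last 3 first.
- by rewrite -abE; exact: mfS.
- by move=> x; rewrite -abE => /subP; rewrite /P /pos_half_line/= in_itv/= andbT lee_fin; exact: f0.
- apply/disj_setPRL => z/=; rewrite !in_itv/= => /andP[xz _] /andP[_ zx].
  by have := lt_le_trans xz zx; rewrite ltxx.
congr (_ + _)%E; apply: integral_itv_obnd_cbnd; apply: mfS => x /=.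
rewrite /P /pos_half_line/= !in_itv/= andbT => /andP[+ _].
exact: lt_trans.
Qed.

Let k0 x := x `^ p * `|derive1 phi x| `^ p * h x.

Let k0_ge0 (x : R) : 0 < x -> 0 <= k0 x.
Proof. by move=> x0; rewrite !mulr_ge0 ?powR_ge0 ?h0. Qed.

Let mk0 : measurable_fun P k0.
Proof.
apply: measurable_funM; last exact: continuous_pos_measurable.
apply: measurable_funM; first exact: measurable_funTS.
apply: (@measurableT_comp _ _ _ _ _ _ (fun x : R => x `^ p)) => //.
apply: measurableT_comp => //; apply: continuous_pos_measurable => x /ddphi ?.
exact/differentiable_continuous/derivable1_diffP.
Qed.

Let k x := (p * K) `^ p * k0 x.

Let k_ge0 (x : R) : 0 < x -> 0 <= k x.
Proof. by move=> x0; rewrite mulr_ge0 ?powR_ge0 ?k0_ge0. Qed.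

Let mk : measurable_fun P k.
Proof. by apply: measurable_funM => //; exact: measurable_cst. Qed.

Let mu_phi : measurable_fun P (fun x => `|phi x - phi xm| `^ p * h x).
Proof.
apply: measurable_funM; last exact: continuous_pos_measurable.
apply: (@measurableT_comp _ _ _ _ _ _ (fun x : R => x `^ p)) => //.
apply: measurableT_comp => //; apply: measurable_funB; last exact: measurable_cst.
apply: continuous_pos_measurable => x /dphi ?.
exact/differentiable_continuous/derivable1_diffP.
Qed.

(** The segment inequality is applied on each side of [xm], with [T = F] on the left and [T = 1 - F]
    on the right. *)
Let hardy_eps (a b eps : R) : 0 < eps -> 0 < a -> a <= xm -> xm <= b ->
  mu.-integrable P (EFin \o k) ->
  (\int[mu]_(x in `[a, b]) (`|phi x - phi xm| `^ p * h x)%:E <=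
   \int[mu]_(x in P) (k x)%:E + (p * eps `^ (p / 2))%:E)%E.
Proof.
move=> eps0 a0 axm xmb ik.
have ikS (u v : R) : 0 < u -> mu.-integrable `[u, v] (EFin \o k).
  by move=> u0; apply: integrableS ik => //; exact: segment_sub_pos.
rewrite split_integral//; last by move=> x x0; rewrite mulr_ge0 ?powR_ge0 ?h0.
have L := @hardy_segment R phi h F (phi xm) p K eps (-1) a xm a0 axm p1 eps0 K0
  dphi ddphi h0 ch.
have {}L := L (normrN1 R) _ _ (ikS _ _ a0).
have Rt := @hardy_segment R phi h (fun x => 1 - F x) (phi xm) p K eps 1 xm b xm0
  xmb p1 eps0 K0 dphi ddphi h0 ch.
have {}Rt := Rt (normr1 R) _ _ (ikS _ _ xm0).
apply: (le_trans (leeD (L _ _) (Rt _ _))).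
- by move=> x /dF; rewrite opprK mul1r.
- move=> x /andP[ax xx]; have /andP[-> _] := F01 x.
  by rewrite Fleft// (lt_le_trans a0).
- move=> x /dF d; have H := is_deriveB (is_derive_cst (1 : R) x 1) d.
  apply: (is_derive_eq H).
  by rewrite sub0r mulN1r.
- by move=> x /andP[xx _]; rewrite Fright// subr_ge0; case/andP : (F01 x) => _ ->.
have kint : (\int[mu]_(x in `[a, xm]) (k x)%:E + \int[mu]_(x in `[xm, b]) (k x)%:E <=
    \int[mu]_(x in P) (k x)%:E)%E.
  rewrite -split_integral//; apply: ge0_subset_integral => //.
  - exact/measurable_EFinP.
  - by move=> x; rewrite /P /pos_half_line/= in_itv/= andbT lee_fin; exact: k_ge0.
  - exact: segment_sub_pos.
rewrite addeACA; apply: leeD => //.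
(* At [xm] the regularized square is exactly [eps], so the two inner boundary terms add up to
   [p eps^(p/2) (F xm + 1 - F xm)]. The outer ones, at [a] and [b], are nonpositive and are
   dropped. *)
rewrite -EFinD lee_fin subrr mul0r add0r.
set e := eps `^ _; set wa := _ `^ (p / 2); set wb := (_ + eps) `^ (p / 2).
have /andP[Fa _] := F01 a; have /andP[_ Fb] := F01 b.
have wa0 : 0 <= wa * F a by rewrite mulr_ge0// powR_ge0.
have wb0 : 0 <= wb * (1 - F b) by rewrite mulr_ge0 ?powR_ge0// subr_ge0.
have -> : p * -1 * (wa * F a - e * F xm) + p * 1 * (e * (1 - F xm) - wb * (1 - F b)) =
  p * (e - wa * F a - wb * (1 - F b)) by ring.
by rewrite ler_pM2l//; lra.
Qed.

(** The bound of [hardy_eps] is uniform over the segments around [xm], so it passes to the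
    half-line; [eps] is arbitrary, so the error term disappears. *)
Lemma hardy_median :
  (\int[mu]_(x in P) (`|phi x - phi xm| `^ p * h x)%:E <=
   ((p * K) `^ p)%:E * \int[mu]_(x in P) (x `^ p * `|derive1 phi x| `^ p * h x)%:E)%E.
Proof.
have kE : (\int[mu]_(x in P) (k x)%:E =
    ((p * K) `^ p)%:E * \int[mu]_(x in P) (k0 x)%:E)%E.
  under eq_integral do rewrite EFinM.
  rewrite ge0_integralZl_EFin//; last by rewrite powR_ge0.
    by move=> x; rewrite /P /pos_half_line/= in_itv/= andbT lee_fin; exact: k0_ge0.
  exact/measurable_EFinP.
rewrite -kE.
(* An infinite right-hand side leaves nothing to prove; a finite one makes [k] integrable. *)
have [koo|] := ltP (\int[mu]_(x in P) (k x)%:E)%E +oo%E; last first.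
  by rewrite leye_eq => /eqP ->; rewrite leey.
have ik : mu.-integrable P (EFin \o k).
  apply: ge0_integrable_EFin => // x.
  by rewrite /P /pos_half_line/= in_itv/= andbT; exact: k_ge0.
apply/lee_addgt0Pr => e e0.
(* The solution of [p eps^(p/2) = e]. *)
pose eps := (e / p) `^ (2 / p).
have eps0 : 0 < eps by apply: powR_gt0; rewrite divr_gt0.
have epsE : p * eps `^ (p / 2) = e.
  rewrite /eps -powRrM (_ : 2 / p * (p / 2) = 1); last by field; rewrite gt_eqF.
  by rewrite powRr1 ?divr_ge0 ?ltW// mulrC divfK// gt_eqF.
rewrite -epsE; apply: (ge0_integral_pos_le xm0) => //.
- by move=> x x0; rewrite mulr_ge0 ?powR_ge0 ?h0.
- by move=> a b a0 axm xmb; exact: hardy_eps.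
Qed.

End hardy_median.

(** * The density [h_bm]: positivity, normalization and derivatives *)

Section h_bm.
Context (R : realType).
Local Notation mu := (@lebesgue_measure R).
Variables (beta m : R).

Let P := @pos_half_line R.

Let mP : measurable P. Proof. exact: measurable_itv. Qed.

Lemma g_bm_gt0 (x : R) : 0 < x -> 0 < g_bm beta m x.
Proof. by move=> x0; rewrite mulr_gt0 ?powR_gt0 ?expR_gt0. Qed.

Lemma is_derive_g_bm (x : R) : 0 < x ->
  is_derive x 1 (g_bm beta m) (g_bm beta m x * (- (2 * beta) / x + m / x ^+ 2)).
Proof.
move=> x0; have xn0 : x != 0 by rewrite gt_eqF.
have dinv := is_deriveV (f := id) xn0 (is_derive_id x 1).
have dmx := is_deriveN (is_deriveM (is_derive_cst m x 1) dinv).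
have dexp := is_derive1_comp (is_derive_expR _) dmx.
have H := is_deriveM (is_derive1_powR (- (2 * beta)) x0) dexp.
apply: (is_derive_eq H).
rewrite powRB ?powRr1 ?(ltW x0)//; last by rewrite xn0 implybT.
rewrite /GRing.scale/= /g_bm; set E := expR _.
by field.
Qed.

Lemma measurable_g_bm : measurable_fun P (g_bm beta m).
Proof.
apply: continuous_pos_measurable => x x0.
exact: is_derive1_continuous (is_derive_g_bm x0).
Qed.

Let g0 x : P x -> (0 <= (g_bm beta m x)%:E)%E.
Proof.
by rewrite /P /pos_half_line/= in_itv/= andbT lee_fin => /g_bm_gt0 /ltW.
Qed.

(* A median can exist only if the mass of [g_bm] is finite and positive: otherwise
   the junk values [fine +oo = 0] and [0^-1 = 0] make the density vanish. *)
Lemma median_C_bm_gt0 (xm : R) : is_median beta m xm -> 0 < C_bm beta m.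
Proof.
move=> med; rewrite lt_neqAle eq_sym invr_ge0 fine_ge0 ?andbT; last exact: integral_ge0.
apply/eqP => C0; move: med; rewrite /is_median integral0_eq.
  by move=> [] /eqP; rewrite eq_sym invr_eq0 pnatr_eq0.
by move=> x _; rewrite /h_bm C0 mul0r.
Qed.

(** For [xm <= 0] the interval [seg0 xm] is empty and carries no mass. *)
Lemma median_gt0 (xm : R) : is_median beta m xm -> 0 < xm.
Proof.
move=> med; rewrite ltNge; apply/negP => xm0; move: med.
rewrite /is_median /seg0 set_itv_ge; last by rewrite bnd_simp -leNgt.
rewrite integral_set0 => -[] /eqP.
by rewrite eq_sym invr_eq0 pnatr_eq0.
Qed.

Lemma median_integral_h_bm (xm : R) : is_median beta m xm ->
  (\int[mu]_(x in P) (h_bm beta m x)%:E = 1)%E.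
Proof.
move=> /median_C_bm_gt0 C0; rewrite /h_bm.
under eq_integral do rewrite EFinM.
rewrite ge0_integralZl_EFin ?(ltW C0)//; last first.
  by apply/measurable_EFinP; exact: measurable_g_bm.
(* Positivity of [C_bm] forces a finite positive mass: [fine] sends both infinities to 0, whose
   inverse is 0. *)
have := C0; rewrite /C_bm -/P; case E : (\int[mu]_(x in P) _)%E => [r| |] /=.
- by rewrite invr_gt0 => r0; rewrite -EFinM mulVf// gt_eqF.
- by rewrite invr0 ltxx.
- by rewrite invr0 ltxx.
Qed.

Lemma is_derive_h_bm (x : R) : 0 < x ->
  is_derive x 1 (h_bm beta m) (h_bm beta m x * (- (2 * beta) / x + m / x ^+ 2)).
Proof.
move=> x0.
have H := is_deriveM (is_derive_cst (C_bm beta m) x 1) (is_derive_g_bm x0).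
by apply: (is_derive_eq H); rewrite /GRing.scale/= /h_bm; ring.
Qed.

(** The factor [1 - 2 * beta + m / x] is the derivative of [ln (x h x)] in the variable [ln x]; it
    decreases in [x] when [m > 0], which is the log-concavity used for the tails. *)
Lemma is_derive_Mh_bm (x : R) : 0 < x ->
  is_derive x 1 (fun y => y * h_bm beta m y)
    (h_bm beta m x * (1 - 2 * beta + m / x)).
Proof.
move=> x0; have H := is_deriveM (is_derive_id x 1) (is_derive_h_bm x0).
by apply: (is_derive_eq H); rewrite /GRing.scale/=; field; rewrite gt_eqF.
Qed.

End h_bm.

(** * Tail bounds, Hardy inequality and centring combined for [h_bm] *)

Theorem theorem4p3 (R : realType) (beta m xbar p : R) (phi : R -> R) :
  2^-1 < beta -> 0 < m -> is_median beta m xbar ->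
  1 <= p -> smooth_pos phi ->
  (Eh beta m (fun x => (`|phi x| `^ p)%R) < +oo)%E ->
  (Eh beta m (fun x => (`|phi x - fine (Eh beta m phi)| `^ p)%R) <=
   ((p * D_bm beta m xbar) `^ p)%R%:E *
   Eh beta m (fun x => (x `^ p * `|derive1 phi x| `^ p)%R))%E.
Proof.
move=> _ m0 med p1 sphi phip.
have p0 : 0 < p := lt_le_trans ltr01 p1.
have C0 := median_C_bm_gt0 med; have xbar0 := median_gt0 med.
have h1 := median_integral_h_bm med.
pose h := h_bm beta m.
have hgt0 (x : R) : 0 < x -> 0 < h x.
  by move=> x0; rewrite mulr_gt0// g_bm_gt0.
have h0 (x : R) : 0 < x -> 0 <= h x by move=> /hgt0 /ltW.
have ch (x : R) : 0 < x -> {for x, continuous h}.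
  by move=> x0; exact: is_derive1_continuous (is_derive_h_bm _ _ x0).
have mh := continuous_pos_measurable ch.
have dphi (x : R) : 0 < x -> derivable phi x 1 := sphi 0%N x.
have ddphi (x : R) : 0 < x -> derivable (derive1 phi) x 1 := sphi 1%N x.
(* This [K] makes [K x h x] equal to 1/2 at the median, the common value of both tails there. *)
pose K := D_bm beta m xbar / 2.
have D0 : 0 < D_bm beta m xbar by rewrite invr_gt0 mulr_gt0// hgt0.
have K0 : 0 < K by rewrite divr_gt0.
have Kxm : K * (xbar * h xbar) = 2^-1.
  by rewrite /K /D_bm mulrAC mulVf ?mul1r// gt_eqF// mulr_gt0// hgt0.
(* The median is defined with an interval open at [xbar], [cdf_pos] with a closed one; a point has
   measure zero. *)
have Fxm : cdf_pos h xbar = 2^-1.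
  apply: EFin_inj; rewrite -cdf_posE// -[RHS]med /seg0 integral_itv_bndo_bndc//.
  apply/measurable_EFinP; apply: measurable_funS mh; first exact: measurable_itv.
  by move=> x; rewrite /pos_half_line/= !in_itv/= andbT => /andP[].
pose s (x : R) := 1 - 2 * beta + m / x.
have s_dec (x y : R) : 0 < x -> x <= y -> s y <= s x.
  move=> x0 xy; rewrite lerD2l ler_pM2l// lef_pV2 ?posrE//.
  exact: lt_le_trans xy.
have dMh (x : R) : 0 < x -> is_derive x 1 (fun y => y * h y) (h x * s x).
  exact: is_derive_Mh_bm.
have hardy := @hardy_median R phi h (cdf_pos h) p K xbar p1 K0 xbar0 dphi ddphi h0 ch
  (is_derive_cdf_pos h0 ch h1) _
  (cdf_left_tail h0 ch h1 K0 dMh s_dec Kxm Fxm)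
  (cdf_right_tail h0 ch h1 xbar0 K0 dMh s_dec Kxm Fxm).
have mphi : measurable_fun (@pos_half_line R) phi.
  apply: continuous_pos_measurable => x /dphi ?.
  exact/differentiable_continuous/derivable1_diffP.
have centered := @centered_moment_le _ _ R (@lebesgue_measure R) (@pos_half_line R) h
  phi p (measurable_itv _) p1 mh mphi _ h1 phip (phi xbar).
apply: (le_trans (centered _)).
  by move=> x; rewrite /pos_half_line/= in_itv/= andbT; exact: h0.
(* The factor [2^p] lost in the centring is exactly what turns [p K] into [p D]. *)
have -> : p * D_bm beta m xbar = 2 * (p * K) by rewrite /K; field.
rewrite powRM ?(mulr_ge0 (ltW p0) (ltW K0))// EFinM -muleA.
apply: lee_wpmul2l; first by rewrite lee_fin powR_ge0.
by apply: hardy => x; rewrite cdf_pos_ge0//= cdf_pos_le1.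
Qed.
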